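(* Let $2\le p\le q\le r$ be integers and let $A=(a_{ijk})$ be a hypermatrix of format $(p,q,r)$ with entries in $\mathbb{C}$, with associated determinantal schemes $\mathcal L\subset\mathbb{P}^{p-1}$, $\mathcal M\subset\mathbb{P}^{q-1}$, $\mathcal N\subset\mathbb{P}^{r-1}$ and kernel $K_A$. Then: (1) If there exists $(P,Q,T)\in K_A$, then $P,Q,T$ are degenerate points of $\mathcal L,\mathcal M,\mathcal N$, respectively. (2) If $\mathcal N$ possesses a degenerate but not bi-degenerate point, then $A$ is degenerate. (3) If $r\ge p+q-1$, then: $A$ is degenerate $\iff$ $\mathcal L$ is degenerate $\iff$ $\mathcal M$ is degenerate. (4) If $r<p+q-1$ and there is a degenerate, not bi-degenerate point in $\mathcal L$ or in $\mathcal M$, then $A$ is degenerate.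
   Context: A hypermatrix of format $(p,q,r)$ is a family $A=(a_{ijk})$, $1\le i\le p$, $1\le j\le q$, $1\le k\le r$, of complex numbers. Kernel and degeneracy of $A$: $K_A$ is the set of triples $(P,Q,T)\in\mathbb{P}^{p-1}\times\mathbb{P}^{q-1}\times\mathbb{P}^{r-1}$ with coordinates $(x_i),(y_j),(z_k)$ such that $\sum_{i,j}a_{ijk}x_iy_j=0$ for all $k$, $\sum_{i,k}a_{ijk}x_iz_k=0$ for all $j$, and $\sum_{j,k}a_{ijk}y_jz_k=0$ for all $i$. $A$ is degenerate if $K_A\neq\emptyset$. Associated matrices of linear forms: $L=(L_{jk})$ is $q\times r$ with $L_{jk}=\sum_i a_{ijk}x_i$; $M=(M_{ik})$ is $p\times r$ with $M_{ik}=\sum_j a_{ijk}y_j$; $N=(N_{ij})$ is $p\times q$ with $N_{ij}=\sum_k a_{ijk}z_k$. The associated schemes $\mathcal L\subset\mathbb{P}^{p-1}$, $\mathcal M\subset\mathbb{P}^{q-1}$, $\mathcal N\subset\mathbb{P}^{r-1}$ are the schemes defined by the ideals generated by the maximal minors of $L,M,N$ respectively. Degenerate points: let $u\le v$, let $B$ be a $u\times v$ matrix of linear forms in $n$ variables, and let $\mathcal S\subseteq\mathbb{P}^{n-1}$ be the scheme defined by the $u\times u$ minors of $B$. For $P\in\mathcal S$ let $J_{\mathcal S}(P)$ be the $\binom{v}{u}\times n$ Jacobian matrix of these minors evaluated at $P$. The point $P\in\mathcal S$ is a degenerate point of $\mathcal S$ if $\operatorname{rk}J_{\mathcal S}(P)<\min\{v-u+1,n\}$;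 it is bi-degenerate if all $(u-1)\times(u-1)$ minors of $B$ vanish at $P$. The scheme $\mathcal S$ is degenerate if it has at least one degenerate point. These notions are applied to $\mathcal L,\mathcal M,\mathcal N$ with $B=L,M,N$ respectively. *)

(* Defs.v *)
From HB Require Import structures.
From mathcomp Require Import all_boot all_order all_algebra.
From mathcomp Require Import reals.
From mathcomp Require Import mpoly.
From mathcomp.real_closed Require Import complex.

Set Implicit Arguments.
Unset Strict Implicit.
Unset Printing Implicit Defensive.

Import GRing.Theory.
Local Open Scope ring_scope.

(* [proj_space K n] is P^(n-1): the lines through the origin of K^n. *)
Definition proj_space (K : fieldType) (n : nat) :=
  {P : {vspace 'rV[K]_n} | \dim P == 1%N}.

(* A chosen vector of homogeneous coordinates. Below it only occurs in
   vanishing conditions on forms and in ranks of matrices all of whose entries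
   are forms of the same degree, so the choice is immaterial. *)
Definition hcoord (K : fieldType) (n : nat) (P : proj_space K n) : 'rV[K]_n :=
  vpick (val P).

Lemma hcoord_neq0 (K : fieldType) (n : nat) (P : proj_space K n) :
  hcoord P != 0.
Proof. by rewrite vpick0 -dimv_eq0 (eqP (valP P)). Qed.

Lemma hcoord_span (K : fieldType) (n : nat) (P : proj_space K n) :
  <[hcoord P]>%VS = val P.
Proof.
apply/eqP; rewrite eqEdim (eqP (valP P)) dim_vline hcoord_neq0 leqnn andbT.
by rewrite -memvE memv_pick.
Qed.

Definition eval_at (K : fieldType) (n : nat) (f : {mpoly K[n]})
    (P : proj_space K n) : K :=
  f.@[hcoord P ord0].

(* Strictly increasing k-tuples of indices; there are 'C(n, k) of them
   (card_ltn_sorted_tuples). *)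
Definition selections (k n : nat) : {set k.-tuple 'I_n} :=
  [set t : k.-tuple 'I_n | sorted ltn (map val t)].

Definition minor (S : comNzRingType) (k u v : nat)
    (s : k.-tuple 'I_u) (t : k.-tuple 'I_v) (B : 'M[S]_(u, v)) : S :=
  \det (mxsub (tnth s) (tnth t) B).

Definition max_minor (S : comNzRingType) (u v : nat)
    (t : u.-tuple 'I_v) (B : 'M[S]_(u, v)) : S :=
  minor (ord_tuple u) t B.

Section DeterminantalScheme.

(* The notions below are meant for u <= v and for B with linear entries. *)
Variables (K : fieldType) (n u v : nat).
Implicit Types (B : 'M[{mpoly K[n]}]_(u, v)) (P : proj_space K n).

Definition on_scheme B P : Prop :=
  forall t, t \in selections u v -> eval_at (max_minor t B) P = 0.

Definition jacobian B P : 'M[K]_(#|selections u v|, n) :=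
  \matrix_(m, l) eval_at (max_minor (enum_val m) B)^`M(l) P.

Definition degenerate_point B P : Prop :=
  on_scheme B P /\ (\rank (jacobian B P) < minn (v - u + 1) n)%N.

Definition bidegenerate_point B P : Prop :=
  on_scheme B P /\
  forall s t, s \in selections u.-1 u -> t \in selections u.-1 v ->
    eval_at (minor s t B) P = 0.

Definition scheme_degenerate B : Prop := exists P, degenerate_point B P.

End DeterminantalScheme.

Definition hypermatrix (K : Type) (p q r : nat) := 'I_p -> 'I_q -> 'I_r -> K.

Section Hypermatrix.

Variables (K : fieldType) (p q r : nat).
Implicit Type A : hypermatrix K p q r.

Definition in_kernel A (P : proj_space K p) (Q : proj_space K q)
    (T : proj_space K r) : Prop :=
  let x := hcoord P ord0 in let y := hcoord Q ord0 in
  let z := hcoord T ord0 in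
  [/\ forall k, \sum_i \sum_j A i j k * x i * y j = 0,
      forall j, \sum_i \sum_k A i j k * x i * z k = 0 &
      forall i, \sum_j \sum_k A i j k * y j * z k = 0].

Definition hyper_degenerate A : Prop := exists P Q T, in_kernel A P Q T.

Definition formsL A : 'M[{mpoly K[p]}]_(q, r) :=
  \matrix_(j, k) \sum_i A i j k *: 'X_i.

Definition formsM A : 'M[{mpoly K[q]}]_(p, r) :=
  \matrix_(i, k) \sum_j A i j k *: 'X_j.

Definition formsN A : 'M[{mpoly K[r]}]_(p, q) :=
  \matrix_(i, j) \sum_k A i j k *: 'X_k.

End Hypermatrix.

(* Main.v *)
(* At a point [x] of the scheme that is not bi-degenerate, the u * v matrix
   [B(x)] has rank [u - 1]; let [w] span its left kernel. To first order the
   maximal minors vanish in the direction [t] iff [w *m B(t)] kills the right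
   kernel of [B(x)], which has dimension [v - u + 1]. Hence the Jacobian has rank
   less than [v - u + 1] iff some nonzero [z] in this right kernel satisfies
   [w *m B(t) *m z^T = 0] for all [t], that is, iff [(x, w, z)] is in the kernel
   of the hypermatrix. That the rank is less than the number [n] of variables
   holds everywhere on the scheme, since [w *m B(x) = 0]. When [n <= v - u + 1],
   such a [z] exists at every point of the scheme by counting dimensions. The
   three schemes are exchanged by permuting the indices of the hypermatrix. *)

Require Import Defs.
From HB Require Import structures.
From mathcomp Require Import all_boot all_order all_algebra.
From mathcomp Require Import reals.
From mathcomp Require Import mpoly.
From mathcomp.real_closed Require Import complex.
From mathcomp Require Import zify ring.

Set Implicit Arguments.
Unset Strict Implicit.
Unset Printing Implicit Defensive.

Local Open Scope ring_scope.
Import GRing.Theory.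

(** * Maximal minors and rank *)

(** Full row rank provides [u] independent columns; enumerating their indices as a set puts them in
    increasing order. *)
Lemma selections_unitmx (K : fieldType) (u v : nat) (M : 'M[K]_(u, v)) :
  row_free M -> exists2 t, t \in selections u v & colsub (tnth t) M \in unitmx.
Proof.
rewrite /row_free -mxrank_tr => Mfull; have {}Mfull : row_full M^T by [].
pose f := fullrankfun Mfull.
have sz : size (enum (f @: 'I_u)) == u.
  by rewrite -cardE card_imset ?card_ord //; apply: fullrankfun_inj.
pose t := Tuple sz; exists t.
  rewrite inE; apply: (subseq_sorted ltn_trans _ (iota_ltn_sorted 0 v)).
  rewrite -val_enum_ord map_subseq //=.
  by rewrite [X in subseq _ X]enumT filter_subseq.
rewrite -unitmx_tr -row_full_unit trmx_mxsub.
have := fullrowsub_full Mfull; rewrite -!sub1mx => /submx_trans; apply.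
apply/row_subP => j; rewrite row_rowsub -/f.
have /tnthP[j' ->] : f j \in t by rewrite mem_enum imset_f.
by rewrite -row_rowsub row_sub.
Qed.

Lemma max_minors_eq0 (K : fieldType) (u v : nat) (M : 'M[K]_(u, v)) :
  (forall t, t \in selections u v -> \det (colsub (tnth t) M) = 0) <->
  (\rank M < u)%N.
Proof.
split=> [M0|rM t _].
  rewrite ltnNge row_leq_rank; apply/negP=> /selections_unitmx[t /M0 dt].
  by rewrite unitmxE dt unitr0.
apply/eqP; rewrite -[_ == 0]negbK -unitfE -unitmxE -row_free_unit -row_leq_rank.
rewrite -ltnNge (leq_ltn_trans _ rM) //.
by rewrite -[M in colsub _ M]mulmx1 -mulmx_colsub mxrankM_maxl.
Qed.

(** * Determinants after replacement of a row *)

Section SetRow.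
Variable S : comNzRingType.

Definition set_row u v (i : 'I_u) (l : 'rV[S]_v) (M : 'M[S]_(u, v)) :=
  \matrix_(j, k) if j == i then l 0 k else M j k.

Lemma colsub_set_row u v v' (i : 'I_u) (l : 'rV[S]_v) M (g : 'I_v' -> 'I_v) :
  colsub g (set_row i l M) = set_row i (colsub g l) (colsub g M).
Proof. by apply/matrixP=> j k; rewrite !mxE. Qed.

Lemma det_set_row n (i : 'I_n) (l : 'rV[S]_n) M :
  \det (set_row i l M) = \sum_k l 0 k * cofactor M i k.
Proof.
rewrite (expand_det_row _ i); apply: eq_bigr => k _; rewrite mxE eqxx.
congr (_ * (_ * \det _)); apply/matrixP=> a c.
by rewrite !mxE eq_sym (negbTE (neq_lift _ _)).
Qed.

(** Cofactor expansion gives entry [i] of [w *m M *m \adj M], and [M *m \adj M] is the scalar matrix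
    of [\det M]. *)
Lemma det_set_row_mul n (i : 'I_n) (w : 'rV[S]_n) M :
  \det (set_row i (w *m M) M) = w 0 i * \det M.
Proof.
transitivity ((w *m M *m \adj M) 0 i).
  rewrite det_set_row [RHS]mxE; apply: eq_bigr => k _.
  by rewrite [(\adj M) _ _]mxE.
by rewrite -mulmxA mul_mx_adj mul_mx_scalar mxE mulrC.
Qed.

End SetRow.

(** * The maximal minors as linear functions of one row *)

Section CofactorMatrix.
Variables (K : fieldType) (u v : nat).

(* Row [m] lists the signed minors of the columns [enum_val m] of [M] with row
   [i] removed, so its product with [l^T] is the maximal minor on these columns
   after [l] has replaced row [i]. *)
Definition cofactor_mx (i : 'I_u) (M : 'M[K]_(u, v)) :
    'M[K]_(#|selections u v|, v) :=
  \matrix_(m, k) \sum_(k' | tnth (enum_val m) k' == k)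
    cofactor (colsub (tnth (enum_val m)) M) i k'.

Lemma cofactor_mxE (i : 'I_u) M n (C : 'M[K]_(n, v)) m l :
  (cofactor_mx i M *m C^T) m l =
  \det (colsub (tnth (enum_val m)) (set_row i (row l C) M)).
Proof.
rewrite mxE colsub_set_row det_set_row.
rewrite (partition_big (tnth (enum_val m)) predT) //=; apply: eq_bigr => k _.
by rewrite !mxE mulr_suml; apply: eq_bigr => k' /eqP <-; rewrite !mxE mulrC.
Qed.

Lemma set_row_sub (i : 'I_u) (l : 'rV[K]_v) M : (set_row i l M <= M + l)%MS.
Proof.
apply/row_subP=> j; have [->|ne] := eqVneq j i.
  have -> : row i (set_row i l M) = l by apply/rowP=> k; rewrite !mxE eqxx.
  exact: addsmxSr.
have -> : row j (set_row i l M) = row j M.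
  by apply/rowP=> k; rewrite !mxE (negbTE ne).
exact: submx_trans (row_sub _ _) (addsmxSl _ _).
Qed.

(** Substituting a row of [M] for row [i] does not enlarge the row space, so all the maximal minors
    still vanish. *)
Lemma cofactor_mx_ker (i : 'I_u) M :
  (\rank M < u)%N -> cofactor_mx i M *m M^T = 0.
Proof.
move=> rM; apply/matrixP=> m j; rewrite cofactor_mxE [RHS]mxE.
apply: (proj2 (max_minors_eq0 _) _ _ (enum_valP m)); apply: leq_ltn_trans rM.
apply/mxrankS/(submx_trans (set_row_sub _ _ _)).
by rewrite addsmx_sub submx_refl row_sub.
Qed.

(** Replacing one row raises the rank by at most one, which leaves it below [u]. *)
Lemma cofactor_mx_eq0 (i : 'I_u) M :
  (\rank M < u.-1)%N -> cofactor_mx i M = 0.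
Proof.
move=> rM; rewrite -[LHS]mulmx1 -(trmx1 _ v).
apply/matrixP=> m k; rewrite cofactor_mxE [RHS]mxE.
apply: (proj2 (max_minors_eq0 _) _ _ (enum_valP m)).
apply: leq_ltn_trans (mxrankS (set_row_sub _ _ _)) _.
apply: leq_ltn_trans (mxrank_adds_leqif _ _) _.
have := rank_leq_row (row k (1%:M : 'M[K]_v)).
by case: u i M rM => [[]|u'] //= i M; lia.
Qed.

(* If a form kills all the rows, then substituting it for row [i] keeps the
   rank below [u], and row [i] depends on the other rows. *)
Lemma cofactor_mx_rank (i : 'I_u) M (w : 'rV[K]_u) :
  \rank M = u.-1 -> w *m M = 0 -> w 0 i != 0 ->
  (v - u.-1 <= \rank (cofactor_mx i M))%N.
Proof.
move=> rM wM wi.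
have u_gt0 : (0 < u)%N by case: u i {M w rM wM wi} => [[]|].
have w0 : w != 0 by apply: contraNneq wi => ->; rewrite mxE.
(* The left kernel has dimension [u - u.-1 = 1], so [w] spans it. *)
have Ew : (kermx M <= w)%MS.
  have sw : (w <= kermx M)%MS by apply/sub_kermxP.
  by rewrite -(mxrank_leqif_sup sw) mxrank_ker rM rank_rV w0; apply/eqP; lia.
set F := cofactor_mx i M.
suff sub : (kermx F^T <= M)%MS.
  by have := mxrankS sub; rewrite mxrank_ker mxrank_tr rM; lia.
apply/row_subP=> k; have lF : F *m (row k (kermx F^T))^T = 0.
  apply: trmx_inj; rewrite trmx_mul trmxK trmx0; apply/sub_kermxP.
  exact: row_sub.
move: (row k _) lF => l lF.
have : (\rank (set_row i l M) < u)%N.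
  apply/max_minors_eq0 => t tsel.
  have := congr1 (fun X : 'M_(_, 1) => X (enum_rank_in tsel t) 0) lF.
  rewrite /F cofactor_mxE enum_rankK_in // [RHS]mxE => <-.
  by congr (\det (colsub _ (set_row _ _ _))); apply/rowP=> c; rewrite !mxE.
rewrite ltnNge row_leq_rank -kermx_eq0 => /rowV0Pn[a /sub_kermxP aM a0].
have Ea : a *m set_row i l M = a 0 i *: (l - row i M) + a *m M.
  apply/rowP=> c; rewrite !mxE (bigD1 i) //= [X in _ = _ + X](bigD1 i) //=.
  rewrite mxE eqxx mulrBr addrA subrK; congr (_ + _).
  by apply: eq_bigr => j ne; rewrite mxE (negbTE ne).
(* If [a 0 i = 0], then [a] is a relation between the rows of [M], hence a multiple of [w]; as
   [w 0 i != 0], it is zero. Otherwise the relation can be solved for [l]. *)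
have [ai|ai] := eqVneq (a 0 i) 0.
  case/negP: a0; move: aM; rewrite Ea ai scale0r add0r => /sub_kermxP.
  move/submx_trans/(_ Ew)/sub_rVP=> [c Ec]; move: ai; rewrite Ec mxE => /eqP.
  by rewrite mulf_eq0 (negbTE wi) orbF => /eqP ->; rewrite scale0r.
have -> : l = row i M - (a 0 i)^-1 *: (a *m M).
  move/eqP: aM; rewrite Ea addr_eq0 => /eqP Eai.
  by rewrite -scalerN -Eai scalerA mulVf // scale1r addrC subrK.
by rewrite addmx_sub ?row_sub // eqmx_opp scalemx_sub // submxMl.
Qed.

End CofactorMatrix.

(** * Jacobian of the minors of a matrix of linear forms *)

Section LinearForms.
Variables (K : fieldType) (n u v : nat) (A : hypermatrix K n u v).
Implicit Types (P : proj_space K n).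
Implicit Types (x : 'rV[K]_n) (w : 'rV[K]_u) (z : 'rV[K]_v).

Definition slice l : 'M[K]_(u, v) := \matrix_(j, k) A l j k.

Definition eval_forms x : 'M[K]_(u, v) := \sum_l x 0 l *: slice l.

Definition kernel_triple x w z : Prop :=
  [/\ w *m eval_forms x = 0, eval_forms x *m z^T = 0 &
      forall l, w *m slice l *m z^T = 0].

(* Row [l] is the derivative of [w *m eval_forms x] in the variable [l]. *)
Definition directional_rows w : 'M[K]_(n, v) := \matrix_l (w *m slice l).

Lemma mul_directional_rows w x :
  x *m directional_rows w = w *m eval_forms x.
Proof.
rewrite mulmx_sum_row mulmx_sumr; apply: eq_bigr => l _.
by rewrite rowK scalemxAr.
Qed.

Lemma map_formsL x : map_mx (meval (x ord0)) (formsL A) = eval_forms x.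
Proof.
apply/matrixP=> j k; rewrite !mxE summxE raddf_sum; apply: eq_bigr => l _.
by rewrite /= mevalZ mevalXU !mxE mulrC.
Qed.

Lemma mderiv_formsL j k l : (formsL A j k)^`M(l) = (A l j k)%:MP.
Proof.
rewrite mxE raddf_sum (bigD1 l) //= big1 => [|l' ne].
  rewrite mderivZ mderivX mnm1E eqxx addr0 scale1r.
  have -> : (U_(l) - U_(l))%MM = 0%MM by apply/mnmP=> a; rewrite !mnmE subnn.
  by rewrite mpolyX0 alg_mpolyC.
by rewrite mderivZ mderivX mnm1E (negbTE ne) scale0r scaler0.
Qed.

Lemma eval_minor k (s : k.-tuple 'I_u) (t : k.-tuple 'I_v) P :
  eval_at (minor s t (formsL A)) P =
  \det (mxsub (tnth s) (tnth t) (eval_forms (hcoord P))).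
Proof. by rewrite /eval_at /minor -det_map_mx map_mxsub map_formsL. Qed.

Lemma eval_max_minor (t : u.-tuple 'I_v) P :
  eval_at (max_minor t (formsL A)) P =
  \det (colsub (tnth t) (eval_forms (hcoord P))).
Proof.
rewrite eval_minor; congr (\det _).
by apply/matrixP=> j k; rewrite !mxE tnth_ord_tuple.
Qed.

Lemma on_schemeP P :
  on_scheme (formsL A) P <-> (\rank (eval_forms (hcoord P)) < u)%N.
Proof.
rewrite -max_minors_eq0; split=> H t /H; first by rewrite eval_max_minor.
by rewrite -eval_max_minor.
Qed.

(* Replace row [i] by the combination of the rows with coefficients [w]: this
   multiplies the minors by [w 0 i], and since the new row vanishes at [P], only
   its own derivative contributes. *)
Lemma jacobian_formsL P w i :
  w *m eval_forms (hcoord P) = 0 ->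
  w 0 i *: jacobian (formsL A) P =
  cofactor_mx i (eval_forms (hcoord P)) *m (directional_rows w)^T.
Proof.
move=> wB; apply/matrixP=> m l; rewrite cofactor_mxE colsub_set_row.
rewrite det_set_row mxE [jacobian _ _ _ _]mxE; set t := enum_val m.
pose B := colsub (tnth t) (formsL A); pose W := map_mx (@mpolyC n K) w.
have -> : max_minor t (formsL A) = \det B.
  congr (\det _); apply/matrixP=> j k; rewrite !mxE.
  by rewrite tnth_ord_tuple.
have evB : map_mx (meval (hcoord P ord0)) B =
           colsub (tnth t) (eval_forms (hcoord P)).
  by rewrite map_mxsub map_formsL.
have WB0 k : meval (hcoord P ord0) ((W *m B) 0 k) = 0.
  transitivity (map_mx (meval (hcoord P ord0)) (W *m B) 0 k).
    by rewrite [RHS]mxE.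
  rewrite map_mxM evB.
  have -> : map_mx (meval (hcoord P ord0)) W = w.
    by apply/matrixP=> a c; rewrite !mxE mevalC.
  by rewrite mulmx_colsub wB !mxE.
have dWB k : ((W *m B) 0 k)^`M(l) = ((w *m slice l) 0 (tnth t k))%:MP.
  rewrite [(W *m B) _ _]mxE [(w *m slice l) _ _]mxE !raddf_sum.
  apply: eq_bigr => j _; rewrite /= [W _ _]mxE [B _ _]mxE mul_mpolyC mderivZ.
  by rewrite mderiv_formsL mpolyCM mul_mpolyC [slice _ _ _]mxE.
transitivity (meval (hcoord P ord0) (\det (set_row i (W *m B) B))^`M(l)).
  by rewrite det_set_row_mul mxE mul_mpolyC mderivZ mevalZ.
rewrite det_set_row (raddf_sum (mderiv l)) (raddf_sum (meval _)).
apply: eq_bigr => k _.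
rewrite /= mderivM mevalD mevalM [X in _ + X]mevalM WB0 mul0r addr0.
rewrite dWB mevalC -evB cofactor_map_mx; congr (_ * _).
by rewrite [RHS]mxE rowK.
Qed.

Lemma kernel_triple_degenerate P w z :
  (u <= v)%N -> w != 0 -> z != 0 -> kernel_triple (hcoord P) w z ->
  degenerate_point (formsL A) P.
Proof.
move=> le_uv w0 z0 [wB Bz wbz]; set B := eval_forms _ in wB Bz.
have [i wi] : exists i, w 0 i != 0 by apply/rV0Pn.
have rB : (\rank B < u)%N.
  rewrite ltnNge row_leq_rank -kermx_eq0; apply/rowV0Pn; exists w => //.
  exact/sub_kermxP.
split; first exact/on_schemeP.
rewrite -(eqmx_scale _ wi) (jacobian_formsL _ wB) -/B.
set F := cofactor_mx i B; set D := directional_rows w.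
have Dz : D *m z^T = 0.
  by apply/row_matrixP=> l; rewrite row_mul rowK row0 wbz.
rewrite leq_min; apply/andP; split.
  (* At a bi-degenerate point the Jacobian is zero. Otherwise the right kernel of [B] has dimension
     [v - u + 1], and its vector [z] is lost under [D^T]. *)
  have [rB'|rB'] := ltnP (\rank B) u.-1.
    by rewrite /F cofactor_mx_eq0 // mul0mx mxrank0 addn1.
  have FB : (F <= kermx B^T)%MS by apply/sub_kermxP/cofactor_mx_ker.
  apply: leq_ltn_trans (mxrankS (submxMr D^T FB)) _.
  have := mxrank_mul_ker (kermx B^T) D^T; rewrite mxrank_ker mxrank_tr.
  have : (z <= kermx B^T :&: kermx D^T)%MS.
    by rewrite sub_capmx; apply/andP; split; apply/sub_kermxP; apply: trmx_inj;
      rewrite trmx_mul trmxK trmx0.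
  by move/mxrankS; rewrite rank_rV z0 /=; lia.
(* The coordinates of [P] give a nontrivial relation between the [n] columns of the Jacobian. *)
have : (hcoord P <= kermx (D *m F^T))%MS.
  by apply/sub_kermxP; rewrite mulmxA mul_directional_rows -/B wB mul0mx.
move/mxrankS; rewrite rank_rV hcoord_neq0 mxrank_ker -mxrank_tr trmx_mul trmxK.
by rewrite subn_gt0.
Qed.

Lemma degenerate_kernel_triple P :
  (u <= v)%N -> degenerate_point (formsL A) P ->
  ~ bidegenerate_point (formsL A) P ->
  exists w z, [/\ w != 0, z != 0 & kernel_triple (hcoord P) w z].
Proof.
move=> le_uv [onP]; rewrite leq_min => /andP[rJ _] nbi.
move: (onP) => /on_schemeP; set B := eval_forms _ => rB.
have rB' : \rank B = u.-1.
  case: (ltnP (\rank B) u.-1) => [ltB|]; last by lia.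
  case: nbi; split=> // s t _ _; rewrite eval_minor -/B.
  apply: contraTeq ltB => ds; rewrite -leqNgt.
  have : row_free (mxsub (tnth s) (tnth t) B).
    by rewrite row_free_unit unitmxE unitfE.
  rewrite -row_leq_rank => /leq_trans; apply.
  (* Writing the submatrix as a product through [B] bounds its rank by that of [B]. *)
  have -> : mxsub (tnth s) (tnth t) B =
            rowsub (tnth s) 1%:M *m (B *m colsub (tnth t) 1%:M).
    rewrite mulmx_colsub mulmx1 mul_rowsub_mx mul1mx.
    by apply/matrixP=> j k; rewrite !mxE.
  exact: leq_trans (mxrankM_maxr _ _) (mxrankM_maxl _ _).
have [w /sub_kermxP wB w0] : exists2 w : 'rV_u, (w <= kermx B)%MS & w != 0.
  by apply/rowV0Pn; rewrite kermx_eq0 -row_leq_rank -ltnNge.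
have [i wi] : exists i, w 0 i != 0 by apply/rV0Pn.
have rF := cofactor_mx_rank rB' wB wi.
set F := cofactor_mx i B in rF; set D := directional_rows w.
have rFD : (\rank (F *m D^T) < v - u + 1)%N.
  by rewrite -(jacobian_formsL _ wB) (eqmx_scale _ wi).
(* Multiplication by [D^T] lowers the rank of [F], which is at least [v - u + 1], so it kills a
   nonzero vector of the row space of [F]. That row space lies in the right kernel of [B]. *)
have : (F :&: kermx D^T)%MS != 0.
  rewrite -mxrank_eq0; have := mxrank_mul_ker F D^T; lia.
case/rowV0Pn=> z; rewrite sub_capmx => /andP[zF /sub_kermxP zD] z0.
exists w, z; split=> //; split=> //.
  apply: trmx_inj; rewrite trmx_mul trmxK trmx0; apply/sub_kermxP.
  by apply: submx_trans zF _; apply/sub_kermxP/cofactor_mx_ker; rewrite rB'; lia.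
move=> l; have := congr1 (row l \o trmx) zD.
by rewrite /= trmx_mul trmxK trmx0 row_mul rowK row0.
Qed.

(* For a fixed [w], the linear conditions [w *m slice l *m z^T = 0] on the right
   kernel of [B] satisfy the relation with coefficients [hcoord P], so only
   [n - 1] of them count, while this kernel has dimension at least [n]. *)
Lemma on_scheme_kernel_triple P :
  (n + u <= v.+1)%N -> on_scheme (formsL A) P ->
  exists w z, [/\ w != 0, z != 0 & kernel_triple (hcoord P) w z].
Proof.
move=> le_nuv /on_schemeP; set B := eval_forms _ => rB.
have [w /sub_kermxP wB w0] : exists2 w : 'rV_u, (w <= kermx B)%MS & w != 0.
  by apply/rowV0Pn; rewrite kermx_eq0 -row_leq_rank -ltnNge.
set D := directional_rows w.
have rD : (\rank D^T < n)%N.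
  rewrite mxrank_tr ltnNge row_leq_rank -kermx_eq0; apply/rowV0Pn.
  exists (hcoord P); last exact: hcoord_neq0.
  by apply/sub_kermxP; rewrite mul_directional_rows.
have : (kermx B^T :&: kermx D^T)%MS != 0.
  rewrite -mxrank_eq0; have := mxrank_mul_ker (kermx B^T) D^T.
  have := mxrankM_maxr (kermx B^T) D^T.
  rewrite mxrank_ker (mxrank_tr B); lia.
case/rowV0Pn=> z; rewrite sub_capmx => /andP[/sub_kermxP zB /sub_kermxP zD] z0.
exists w, z; split=> //; split=> //.
  by apply: trmx_inj; rewrite trmx_mul trmxK trmx0.
move=> l; have := congr1 (row l \o trmx) zD.
by rewrite /= trmx_mul trmxK trmx0 row_mul rowK row0.
Qed.

End LinearForms.

(** * Permutation of the indices and passage to projective points *)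

Section Kernels.
Variable K : fieldType.

(* [in_kernel A P Q T] is convertible to this at the chosen coordinates. *)
Definition trilinear_kernel p q r (A : hypermatrix K p q r)
    (x : 'rV[K]_p) (y : 'rV[K]_q) (z : 'rV[K]_r) : Prop :=
  [/\ forall k, \sum_i \sum_j A i j k * x 0 i * y 0 j = 0,
      forall j, \sum_i \sum_k A i j k * x 0 i * z 0 k = 0 &
      forall i, \sum_j \sum_k A i j k * y 0 j * z 0 k = 0].

Lemma trilinear_kernelE p q r (A : hypermatrix K p q r) x y z :
  trilinear_kernel A x y z <-> kernel_triple A x y z.
Proof.
have E1 k : (y *m eval_forms A x) 0 k = \sum_i \sum_j A i j k * x 0 i * y 0 j.
  rewrite mulmx_sumr summxE; apply: eq_bigr => i _; rewrite -scalemxAr !mxE.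
  by rewrite mulr_sumr; apply: eq_bigr => j _; rewrite mxE; ring.
have E2 j : (eval_forms A x *m z^T) j 0 = \sum_i \sum_k A i j k * x 0 i * z 0 k.
  rewrite mulmx_suml summxE; apply: eq_bigr => i _; rewrite -scalemxAl !mxE.
  by rewrite mulr_sumr; apply: eq_bigr => k _; rewrite !mxE; ring.
have E3 i : (y *m slice A i *m z^T) 0 0 = \sum_j \sum_k A i j k * y 0 j * z 0 k.
  rewrite -mulmxA mxE; apply: eq_bigr => j _; rewrite mxE mulr_sumr.
  by apply: eq_bigr => k _; rewrite !mxE; ring.
split=> -[H1 H2 H3]; split.
- by apply/rowP=> k; rewrite E1 H1 mxE.
- by apply/colP=> j; rewrite E2 H2 mxE.
- by move=> i; apply/matrixP=> a c; rewrite !ord1 E3 H3 mxE.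
- by move=> k; rewrite -E1 H1 mxE.
- by move=> j; rewrite -E2 H2 mxE.
- by move=> i; rewrite -E3 H3 mxE.
Qed.

(* [formsM A] and [formsN A] are convertible to [formsL] of the permuted
   hypermatrices below. *)
Lemma trilinear_kernelM p q r (A : hypermatrix K p q r) x y z :
  trilinear_kernel A x y z <-> trilinear_kernel (fun j i k => A i j k) y x z.
Proof.
by split=> -[H1 H2 H3]; split=> // k; rewrite -[RHS](H1 k) exchange_big;
   do 2 (apply: eq_bigr => ? _); rewrite mulrAC.
Qed.

Lemma trilinear_kernelN p q r (A : hypermatrix K p q r) x y z :
  trilinear_kernel A x y z <-> trilinear_kernel (fun k i j => A i j k) z x y.
Proof.
split=> -[H1 H2 H3]; split=> // a;
  [rewrite -[RHS](H2 a)|rewrite -[RHS](H3 a)|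
   rewrite -[RHS](H1 a)|rewrite -[RHS](H2 a)];
  rewrite exchange_big; apply: eq_bigr => ? _; apply: eq_bigr => ? _;
  by rewrite mulrAC.
Qed.

(** Used to pass from given vectors to the coordinates chosen by [hcoord], which are only multiples
    of them. *)
Lemma trilinear_kernelZ p q r (A : hypermatrix K p q r) x y z a b c :
  trilinear_kernel A x y z -> trilinear_kernel A (a *: x) (b *: y) (c *: z).
Proof.
case=> H1 H2 H3; split=> [k|j|i].
- rewrite -[RHS](mulr0 (a * b)) -[X in _ = _ * X](H1 k) mulr_sumr.
  apply: eq_bigr => i _.
  by rewrite mulr_sumr; apply: eq_bigr => j _; rewrite !mxE; ring.
- rewrite -[RHS](mulr0 (a * c)) -[X in _ = _ * X](H2 j) mulr_sumr.
  apply: eq_bigr => i _.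
  by rewrite mulr_sumr; apply: eq_bigr => k _; rewrite !mxE; ring.
rewrite -[RHS](mulr0 (b * c)) -[X in _ = _ * X](H3 i) mulr_sumr.
apply: eq_bigr => j _.
by rewrite mulr_sumr; apply: eq_bigr => k _; rewrite !mxE; ring.
Qed.

Lemma proj_space_of n (x : 'rV[K]_n) :
  x != 0 -> exists (P : proj_space K n) c, hcoord P = c *: x.
Proof.
move=> x0; have dx : \dim <[x]>%VS == 1%N by rewrite dim_vline x0.
exists (exist _ <[x]>%VS dx); apply/vlineP; exact: memv_pick.
Qed.

Lemma trilinear_kernel_degenerate p q r (A : hypermatrix K p q r) x y z :
  x != 0 -> y != 0 -> z != 0 -> trilinear_kernel A x y z -> hyper_degenerate A.
Proof.
move=> /proj_space_of[P [a EP]] /proj_space_of[Q [b EQ]] /proj_space_of[T [c ET]].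
move=> H; exists P, Q, T; rewrite /in_kernel EP EQ ET.
exact: trilinear_kernelZ H.
Qed.

Lemma in_kernel_degenerate_point p q r (A : hypermatrix K p q r) P Q T :
  (q <= r)%N -> in_kernel A P Q T -> degenerate_point (formsL A) P.
Proof.
move=> le_qr H.
apply: (kernel_triple_degenerate le_qr (hcoord_neq0 Q) (hcoord_neq0 T)).
exact/trilinear_kernelE.
Qed.

Lemma degenerate_point_hyper p q r (A : hypermatrix K p q r) P :
  (q <= r)%N -> degenerate_point (formsL A) P ->
  ~ bidegenerate_point (formsL A) P -> hyper_degenerate A.
Proof.
move=> le_qr dP nbP.
have [y [z [y0 z0 /trilinear_kernelE]]] := degenerate_kernel_triple le_qr dP nbP.
exact: trilinear_kernel_degenerate (hcoord_neq0 P) y0 z0.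
Qed.

Lemma on_scheme_hyper p q r (A : hypermatrix K p q r) P :
  (p + q <= r.+1)%N -> on_scheme (formsL A) P -> hyper_degenerate A.
Proof.
move=> le_pqr oP.
have [y [z [y0 z0 /trilinear_kernelE]]] := on_scheme_kernel_triple le_pqr oP.
exact: trilinear_kernel_degenerate (hcoord_neq0 P) y0 z0.
Qed.

Lemma hyper_degenerateM p q r (A : hypermatrix K p q r) :
  hyper_degenerate (fun j i k => A i j k) -> hyper_degenerate A.
Proof. by move=> [Q [P [T /trilinear_kernelM]]]; exists P, Q, T. Qed.

Lemma hyper_degenerateN p q r (A : hypermatrix K p q r) :
  hyper_degenerate (fun k i j => A i j k) -> hyper_degenerate A.
Proof.
by move=> [T [P [Q H]]]; exists P, Q, T; apply/trilinear_kernelN.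
Qed.

End Kernels.

Theorem theorem3p8 (R : realType) (p q r : nat) (A : hypermatrix R[i] p q r)
    (hp : (2 <= p)%N) (hpq : (p <= q)%N) (hqr : (q <= r)%N) :
  [/\ forall (P : proj_space R[i] p) (Q : proj_space R[i] q)
             (T : proj_space R[i] r),
        in_kernel A P Q T ->
        [/\ degenerate_point (formsL A) P, degenerate_point (formsM A) Q
          & degenerate_point (formsN A) T],
      (exists T : proj_space R[i] r,
         degenerate_point (formsN A) T /\ ~ bidegenerate_point (formsN A) T) ->
        hyper_degenerate A,
      (p + q - 1 <= r)%N ->
        (hyper_degenerate A <-> scheme_degenerate (formsL A)) /\
        (scheme_degenerate (formsL A) <-> scheme_degenerate (formsM A))
    & (r < p + q - 1)%N ->
        (exists P : proj_space R[i] p,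
           degenerate_point (formsL A) P /\ ~ bidegenerate_point (formsL A) P)
        \/
        (exists Q : proj_space R[i] q,
           degenerate_point (formsM A) Q /\ ~ bidegenerate_point (formsM A) Q) ->
        hyper_degenerate A].
Proof.
have hpr := leq_trans hpq hqr.
have kernel_points P Q T : in_kernel A P Q T ->
    [/\ degenerate_point (formsL A) P, degenerate_point (formsM A) Q
      & degenerate_point (formsN A) T].
  move=> H; split.
  - exact: in_kernel_degenerate_point hqr H.
  (* The permuted formats are [(q, p, r)] here and [(r, p, q)] for [formsN], so the inequalities
     required are [p <= r] and [p <= q]. *)
  - apply: (@in_kernel_degenerate_point _ _ _ _ _ Q P T hpr).
    exact: (proj1 (trilinear_kernelM _ _ _ _) H).
  apply: (@in_kernel_degenerate_point _ _ _ _ _ T P Q hpq).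
  exact: (proj1 (trilinear_kernelN _ _ _ _) H).
split=> //.
- move=> [T [dT nbT]]; apply: hyper_degenerateN.
  exact: degenerate_point_hyper hpq dT nbT.
- move=> hr.
  have AL : hyper_degenerate A -> scheme_degenerate (formsL A).
    by move=> [P [Q [T /kernel_points[dP _ _]]]]; exists P.
  have AM : hyper_degenerate A -> scheme_degenerate (formsM A).
    by move=> [P [Q [T /kernel_points[_ dQ _]]]]; exists Q.
  have LA : scheme_degenerate (formsL A) -> hyper_degenerate A.
    by move=> [P [oP _]]; apply: on_scheme_hyper oP; lia.
  (* The bound [p + q <= r.+1] is symmetric in [p] and [q], so it survives the exchange of the first
     two indices. *)
  have MA : scheme_degenerate (formsM A) -> hyper_degenerate A.
    move=> [Q [oQ _]]; apply: hyper_degenerateM.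
    by apply: on_scheme_hyper oQ; lia.
  by split; split=> // H; [apply/AM/LA|apply/AL/MA].
move=> _ [[P [dP nbP]]|[Q [dQ nbQ]]].
  exact: degenerate_point_hyper hqr dP nbP.
by apply: hyper_degenerateM; apply: degenerate_point_hyper hpr dQ nbQ.
Qed.
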